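(* Let $R$ be a commutative ring with identity $1\neq 0$ such that $\overline{\Gamma}(R)\neq\Gamma(R)$. Then $\overline{\Gamma}(R)$ is uniquely complemented if and only if $\overline{\Gamma}(R)$ is complemented.
   Context: $Z(R)$ is the set of zero-divisors of $R$ (including $0$) and $Z(R)^*=Z(R)\setminus\{0\}$. The zero-divisor graph $\Gamma(R)$ is the simple graph with vertex set $Z(R)^*$ in which two distinct vertices $x,y$ are adjacent if and only if $xy=0$. The extended zero-divisor graph $\overline{\Gamma}(R)$ is the simple graph with the same vertex set $Z(R)^*$ in which two distinct vertices $x,y$ are adjacent if and only if there exist positive integers $n,m$ with $x^ny^m=0$, $x^n\neq 0$ and $y^m\neq 0$. In a simple graph $G$, two vertices $u,v$ are orthogonal, written $u\perp v$, if they are adjacent and no vertex is adjacent to both of them. $G$ is complemented if for every vertex $v$ there is a vertex $u$ with $v\perp u$. Write $u\sim w$ if the open neighborhoods of $u$ and $w$ coincide, i.e. $N(u)=N(w)$, where $N(u)$ is the set of vertices adjacent to $u$. $G$ is uniquely complemented if it is complemented and, for all vertices $u,v,w$, $v\perp u$ and $v\perp w$ imply $u\sim w$. *)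

(* Defs.v *)
From HB Require Import structures.
From mathcomp Require Import all_boot all_order all_algebra.
From mathcomp Require Import boolp classical_sets.

Set Implicit Arguments.
Unset Strict Implicit.
Unset Printing Implicit Defensive.

Import GRing.Theory.
Local Open Scope classical_set_scope.
Local Open Scope ring_scope.

Record simple_graph (T : Type) := SimpleGraph {
  vertex : set T;
  adj : T -> T -> Prop;
  adj_vertex : forall x y, adj x y -> vertex x /\ vertex y;
  adj_sym : forall x y, adj x y -> adj y x;
  adj_irrefl : forall x, ~ adj x x
}.

(* Leibniz equality of graphs amounts to having the same vertices and the same
   edges. *)
Lemma simple_graphP (T : Type) (G H : simple_graph T) :
  G = H <-> vertex G = vertex H /\ (forall x y, adj G x y <-> adj H x y).
Proof.
split=> [->//|]; case: G H => [V E p q r] [V' E' p' q' r'] /= [eV eE].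
have {}eE : E = E' by apply/funext => x; apply/funext => y; apply/propext.
by subst V' E'; congr SimpleGraph; apply: Prop_irrelevance.
Qed.

Section GraphNotions.
Variables (T : Type) (G : simple_graph T).

Definition open_nbhd (u : T) : set T := [set x | adj G u x].

Definition orthogonal (u v : T) : Prop :=
  adj G u v /\ ~ (exists w, adj G w u /\ adj G w v).

Definition complemented : Prop :=
  forall v, vertex G v -> exists u, vertex G u /\ orthogonal v u.

Definition uniquely_complemented : Prop :=
  complemented /\
  forall u v w, vertex G u -> vertex G v -> vertex G w ->
    orthogonal v u -> orthogonal v w -> open_nbhd u = open_nbhd w.

End GraphNotions.

Section ZeroDivisorGraphs.
Variable R : comNzRingType.

Definition zero_divisors : set R := [set x | exists y, y != 0 /\ x * y = 0].

Definition nz_zero_divisors : set R := zero_divisors `\ 0.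

Definition zd_adj (x y : R) : Prop :=
  [/\ nz_zero_divisors x, nz_zero_divisors y, x <> y & x * y = 0].

Definition ext_zd_adj (x y : R) : Prop :=
  [/\ nz_zero_divisors x, nz_zero_divisors y, x <> y &
      exists n m : nat, [/\ (0 < n)%N, (0 < m)%N, x ^+ n * y ^+ m = 0,
                            x ^+ n != 0 & y ^+ m != 0]].

Lemma zd_adj_vertex x y :
  zd_adj x y -> nz_zero_divisors x /\ nz_zero_divisors y.
Proof. by case. Qed.

Lemma zd_adj_sym x y : zd_adj x y -> zd_adj y x.
Proof. by case=> Zx Zy xy xy0; split=> //; [move/esym | rewrite mulrC]. Qed.

Lemma zd_adj_irrefl x : ~ zd_adj x x.
Proof. by case. Qed.

Lemma ext_zd_adj_vertex x y :
  ext_zd_adj x y -> nz_zero_divisors x /\ nz_zero_divisors y.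
Proof. by case. Qed.

Lemma ext_zd_adj_sym x y : ext_zd_adj x y -> ext_zd_adj y x.
Proof.
case=> Zx Zy xy [n [m [n0 m0 xy0 xn0 ym0]]]; split=> //; first by move/esym.
by exists m, n; split=> //; rewrite mulrC.
Qed.

Lemma ext_zd_adj_irrefl x : ~ ext_zd_adj x x.
Proof. by case. Qed.

Definition zero_divisor_graph : simple_graph R :=
  SimpleGraph zd_adj_vertex zd_adj_sym zd_adj_irrefl.

Definition extended_zero_divisor_graph : simple_graph R :=
  SimpleGraph ext_zd_adj_vertex ext_zd_adj_sym ext_zd_adj_irrefl.

End ZeroDivisorGraphs.

(* Main.v *)
Require Import Defs.
From mathcomp Require Import all_boot all_algebra.
From mathcomp Require Import boolp classical_sets.

Import GRing.Theory.
Local Open Scope ring_scope.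

(** In a complemented extended graph nilpotent elements have square zero: if
    [x] had nilpotency index [k >= 3], its only possible complement would be
    [x ^+ k.-1], but [x + x ^+ k.-1] is adjacent to both.  Moreover two
    orthogonal elements of square zero are opposite, since their sum
    annihilates both.

    Let [v] be orthogonal to [u] and to [w], and suppose that [a] is adjacent
    to [u] but not to [w].  If [a ^+ i * u ^+ j = 0] and [v ^+ r * w ^+ t = 0],
    then [c = a ^+ i * w ^+ t] is nonzero and killed by [u ^+ j] and [v ^+ r];
    as it cannot be adjacent to both [u] and [v], it is one of them, and hence
    nilpotent.  If [c = v], then [w] has square zero, so [w = - v] is adjacent
    to [u] as well as [v].  If [c = u], then [a] has square zero, and [u], being
    a multiple of [a], is adjacent to every other complement of [a]; so [u] is
    its complement, and [a = - u] is adjacent to [v] as well as [u]. *)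

Section ExtendedGraph.
Set Implicit Arguments.
Unset Strict Implicit.
Variable R : comNzRingType.
Implicit Types x y z u v w a : R.

Local Notation G := (extended_zero_divisor_graph R).
Local Notation orthogonal := (Defs.orthogonal G).

Lemma neq0_of_expr x n : (0 < n)%N -> x ^+ n != 0 -> x != 0.
Proof. by move=> n0; apply: contraNneq => ->; rewrite expr0n gtn_eqF. Qed.

(** The last nonzero term of [y], [x * y], ..., [x ^+ n * y] is killed by [x]. *)
Lemma zero_divisors_expr x y n : x ^+ n * y = 0 -> y != 0 -> zero_divisors x.
Proof.
elim: n y => [|n IHn] y; first by rewrite mul1r => -> /eqP.
rewrite exprSr -mulrA; have [xy0 _ y0|xy0 /IHn/(_ xy0) //] := eqVneq (x * y) 0.
by exists y.
Qed.

Lemma ext_adjI n m x y : (0 < n)%N -> (0 < m)%N -> x <> y ->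
  x ^+ n * y ^+ m = 0 -> x ^+ n != 0 -> y ^+ m != 0 -> adj G x y.
Proof.
move=> n0 m0 xy xy0 xn ym; split=> //; last by exists n, m.
- split; first exact: zero_divisors_expr xy0 ym.
  by apply/eqP; exact: neq0_of_expr xn.
- split; first by apply: (@zero_divisors_expr y (x ^+ n) m); rewrite // mulrC.
  by apply/eqP; exact: neq0_of_expr ym.
Qed.

Lemma ext_adjP x y : adj G x y -> exists n m : nat,
  [/\ (0 < n)%N, (0 < m)%N, x ^+ n * y ^+ m = 0, x ^+ n != 0 & y ^+ m != 0].
Proof. by case. Qed.

Lemma ext_adj1l x y m : (0 < m)%N -> x <> y -> x != 0 -> y ^+ m != 0 ->
  x * y ^+ m = 0 -> adj G x y.
Proof. by move=> m0 xy x0 ym xy0; apply: (@ext_adjI 1 m). Qed.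

(** Fixes at 1 the exponent that an adjacency gives to an element of square zero. *)
Lemma sqr0_expr1 x n : x ^+ 2 = 0 -> (0 < n)%N -> x ^+ n != 0 -> n = 1%N.
Proof. by case: n => [|[|n]] // x2 _; rewrite -addn2 exprD x2 mulr0 eqxx. Qed.

Lemma complemented_sqr0 x n : complemented G -> x ^+ n = 0 -> x ^+ 2 = 0.
Proof.
move=> cG xn; have [->|x0] := eqVneq x 0; first by rewrite expr0n.
have exn : exists n, x ^+ n == 0 by exists n; apply/eqP.
have [k /eqP xk kmin] := ex_minnP exn.
have [k2|k3] := leqP k 2; first by rewrite -(subnKC k2) exprD xk mul0r.
(* The nilpotency index is now [k.+1], so that [w] is the last nonzero power of [x]. *)
case: k k3 xk kmin => [|k] // k2 xk kmin; set w := x ^+ k.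
have k0 : (0 < k)%N by exact: ltnW.
have w0 : w != 0 by apply/negP => /kmin; rewrite ltnn.
have x2 : x ^+ 2 != 0 by apply/negP => /kmin; rewrite leqNgt k2.
have xw : x * w = 0 by rewrite /w -exprS.
have w2 : w * w = 0 by rewrite {1}/w -(prednK k0) exprSr -mulrA xw mulr0.
have wx : w <> x by move=> e; case/eqP: x2; rewrite expr2 -{2}e.
have Vx : vertex G x by split; [exists w | apply/eqP].
have [u [Vu [xu nxu]]] := cG x Vx.
have [i [j [i0 j0 xuij xi uj]]] := ext_adjP xu.
have ik : (i <= k)%N.
  rewrite leqNgt; apply/negP => ki; case/eqP: xi.
  by rewrite -(subnKC ki) exprD xk mul0r.
(* Since [i <= k], [u ^+ j] kills [w]; if [u] were not [w], then [w] would be adjacent to both [x]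
   and [u]. *)
have [uw|/eqP uw] := eqVneq w u; last first.
  apply: absurd nxu; exists w; split.
    by apply: (@ext_adj1l w x 1); rewrite // mulrC.
  apply: (@ext_adj1l w u j) => //.
  by rewrite /w -(subnK ik) exprD -mulrA xuij mulr0.
have xw0 : x + w != 0.
  by rewrite addr_eq0; apply: contraNneq x2 => e; rewrite expr2 {2}e mulrN xw oppr0.
apply: absurd nxu; exists (x + w); rewrite -uw; split.
  apply: (@ext_adj1l _ x k) => //; last by rewrite -/w mulrDl xw w2 addr0.
  by move=> /eqP; rewrite -subr_eq0 addrC addKr (negPf w0).
apply: (@ext_adj1l _ w 1) => //; last by rewrite mulrDl xw w2 addr0.
by move=> /eqP; rewrite -subr_eq0 addrK (negPf x0).
Qed.

Lemma orthogonal_sqr0 u v :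
  orthogonal u v -> u ^+ 2 = 0 -> v ^+ 2 = 0 -> v = - u.
Proof.
move=> [uv nuv] u2 v2.
have [i [j [i0 j0 uvij ui vj]]] := ext_adjP uv.
have i1 := sqr0_expr1 u2 i0 ui; have j1 := sqr0_expr1 v2 j0 vj.
move: uvij ui vj; rewrite i1 j1 !expr1 => uv0 u0 v0; apply/eqP; rewrite -addr_eq0.
apply/negPn/negP => vu0; apply: nuv; exists (v + u); split.
  apply: (@ext_adj1l _ u 1) => //.
    by move=> /eqP; rewrite -subr_eq0 addrK (negPf v0).
  by rewrite mulrDl mulrC uv0 -expr2 u2 addr0.
apply: (@ext_adj1l _ v 1) => //.
  by move=> /eqP; rewrite -subr_eq0 addrC addKr (negPf u0).
by rewrite mulrDl uv0 -expr2 v2 addr0.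
Qed.

Lemma complemented_nbhd_sub u v w : complemented G ->
  orthogonal v u -> orthogonal v w ->
  (open_nbhd G u `<=` open_nbhd G w)%classic.
Proof.
move=> cG [vu nvu] ovw a ua; have [vw nvw] := ovw.
apply: contrapT => nwa.
have au : adj G a u by exact: adj_sym.
have wv : adj G w v by exact: adj_sym.
have neq_aw : a <> w by move=> e; apply: nvu; exists a; rewrite {1}e.
have neq_av : a <> v by move=> e; apply: nwa; rewrite e.
have neq_wu : w <> u by move=> e; apply: nwa; rewrite e.
have naw n m : (0 < n)%N -> (0 < m)%N -> a ^+ n != 0 -> w ^+ m != 0 ->
    a ^+ n * w ^+ m != 0.
  move=> n0 m0 an wm; apply/eqP => e; apply: nwa; apply: adj_sym.
  exact: ext_adjI e an wm.
have [i [j [i0 j0 auij ai uj]]] := ext_adjP au.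
have [r [t [r0 t0 vwrt vr wt]]] := ext_adjP vw.
pose c := a ^+ i * w ^+ t.
have c0 : c != 0 by exact: naw.
have cu : c * u ^+ j = 0 by rewrite /c mulrAC auij mul0r.
have cv : c * v ^+ r = 0 by rewrite /c -mulrA [w ^+ t * _]mulrC vwrt mulr0.
have [ecu|/eqP ncu] := eqVneq c u.
  have u2 : u ^+ 2 = 0.
    by apply: (@complemented_sqr0 _ j.+1) => //; rewrite exprS -{1}ecu.
  have j1 := sqr0_expr1 u2 j0 uj.
  (* As [j = 1], [a ^+ (i + i) * w ^+ t = a ^+ i * c = a ^+ i * u ^+ j = 0], so [naw] forces the
     power of [a] to vanish. *)
  have a2i : a ^+ (i + i) = 0.
    apply: contrapT => /eqP/naw-/(_ t _ t0 wt)/eqP; apply; first by rewrite addn_gt0 i0.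
    by rewrite exprD -mulrA -/c ecu -[u]expr1 -j1.
  have a2 : a ^+ 2 = 0 by exact: complemented_sqr0 a2i.
  have i1 := sqr0_expr1 a2 i0 ai.
  have [Va _] := adj_vertex au.
  have [b [Vb oab]] := cG a Va.
  have [ab nab] := oab.
  have [i' [k [i'0 k0 abk ai' bk]]] := ext_adjP ab.
  have i'1 := sqr0_expr1 a2 i'0 ai'.
  have u0 : u != 0 by rewrite -ecu.
  have [eub|/eqP nub] := eqVneq u b; last first.
    apply: nab; exists u; split; first exact: ua.
    apply: (@ext_adj1l u b k) => //.
    (* As [i] and [i'] are both 1, [c] is a multiple of [a ^+ i'], which [b ^+ k] kills. *)
    by rewrite -ecu /c i1 -{1}i'1 mulrAC abk mul0r.
  have eua : u = - a by apply: orthogonal_sqr0 => //; rewrite eub.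
  apply: nvu; exists a; split => //.
  apply: (@ext_adj1l a v r) => //; first by rewrite -oppr_eq0 -eua.
  by apply/eqP; rewrite -oppr_eq0 -mulNr -eua -ecu cv.
have [ecv|/eqP ncv] := eqVneq c v; last first.
  by apply: nvu; exists c; split; [exact: ext_adj1l cv | exact: ext_adj1l cu].
have v2 : v ^+ 2 = 0.
  by apply: (@complemented_sqr0 _ r.+1) => //; rewrite exprS -{1}ecv.
have r1 := sqr0_expr1 v2 r0 vr.
(* The same argument for [w], with [c * w ^+ t = v ^+ r * w ^+ t = 0]. *)
have w2t : w ^+ (t + t) = 0.
  apply: contrapT => /eqP/(naw i _ i0 _ ai)/eqP; apply; first by rewrite addn_gt0 t0.
  by rewrite exprD mulrA -/c ecv -[v]expr1 -{1}r1.
have w2 : w ^+ 2 = 0 by exact: complemented_sqr0 w2t.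
have ewv : w = - v by exact: orthogonal_sqr0.
have [p [q [p0 q0 vupq vp uq]]] := ext_adjP vu.
have p1 := sqr0_expr1 v2 p0 vp.
apply: nvu; exists w; split => //; apply: (@ext_adj1l w u q) => //.
  by rewrite ewv oppr_eq0 -ecv.
by rewrite ewv mulNr -[v]expr1 -{1}p1 vupq oppr0.
Qed.

End ExtendedGraph.

Theorem theorem3p2 (R : comNzRingType)
  (neq : extended_zero_divisor_graph R <> zero_divisor_graph R) :
  uniquely_complemented (extended_zero_divisor_graph R) <->
  complemented (extended_zero_divisor_graph R).
Proof.
split=> [[]//|cG]; split=> // u v w _ _ _ vu vw.
by apply/seteqP; split; [exact: complemented_nbhd_sub vu vw
                        | exact: complemented_nbhd_sub vw vu].
Qed.
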